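(* Let $U,W:\mathbb R\to\mathbb R$ be twice continuously differentiable utility functions such that $U$ is more risk averse than $W$, i.e. $l_U(x)\ge l_W(x)$ for all $x\in\mathbb R$. Then for all $(t,i)\in[0,\infty)\times S$, $h^*(t,i,W)=0$ implies $h^*(t,i,U)=0$.
   Context: Markov chain: on a probability space $(\Omega,\mathcal F,\mathbb P)$, $(X_t)_{t\ge0}$ is a right-continuous continuous-time Markov chain with countable state space $S$ and intensity matrix $Q=(q_{ij})$, $0<q_i:=-q_{ii}=\sum_{j\ne i}q_{ij}<\infty$. Its jump times are $0=S_0<S_1<S_2<\dots$, $Z_n:=X_{S_n}$, and $X_t=\sum_{k\ge0}Z_k1_{\{S_k\le t<S_{k+1}\}}$ for all $t\ge0$; $S_{k+1}-S_k\sim\exp(q_{Z_k})$ and $\mathbb P(Z_{k+1}=j\mid Z_k=i)=q_{ij}/q_i$ for $j\ne i$. $(\mathcal F^X_t)$ is the natural filtration of $X$; $\mathbb P_i,\mathbb E_i$ denote probability and expectation given $X_0=i$. $g:S\to\mathbb R$ is a reward function and $c>0$ a cost rate. $\Sigma$ is the set of $(\mathcal F^X_t)$-stopping times $\tau:\Omega\to[0,\infty)$ with $\mathbb P_i(\tau<\infty)=1$ for all $i\in S$. Utility functions: strictly increasing and strictly concave; the Arrow–Pratt function of absolute risk aversion is $l_U(x)=-U''(x)/U'(x)$, similarly for $W$. Standing assumptions (for both utility functions): (A1) $\sup_{\tau\in\Sigma}\mathbb E_i[g^+(X_\tau)-c\tau]<\infty$ for all $i\in S$; (A2) $\liminf_{n\to\infty}\mathbb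 E_i[U(g(X_{\tau\wedge S_n})-c(t+\tau\wedge S_n))]\ge\mathbb E_i[U(g(X_\tau)-c(t+\tau))]$ for all $i\in S$, $t\ge0$, $\tau\in\Sigma$, and likewise with $W$ in place of $U$. Markovian stopping times: a Markovian stopping time is identified with a sequence $\tau=(h_0,h_1,\dots)$ of measurable maps $h_k:[0,\infty)\times S\to[0,\infty]$; given elapsed time $t\ge0$ it denotes the random time $\tau=S_k+h_k(t+S_k,Z_k)$ for the smallest $k\ge0$ with $S_k+h_k(t+S_k,Z_k)<S_{k+1}$ (and $\tau=\infty$ if there is none). $\Sigma^M$ is the class of such sequences for which $\tau$ is $\mathbb P_i$-a.s. finite for all $i\in S$, $t\ge0$. Value function and maximizer: $V(t,i,U):=\sup_{\tau\in\Sigma^M}\mathbb E_i\big[U\big(g(X_\tau)-c(t+\tau)\big)\big]$, with $\tau$ formed with elapsed time $t$; it satisfies $$V(t,i,U)=\sup_{\vartheta\ge0}\Big\{U\big(g(i)-c(t+\vartheta)\big)e^{-q_i\vartheta}+\int_0^\vartheta e^{-q_is}\sum_{j\ne i}q_{ij}V(t+s,j,U)\,ds\Big\}.$$ $h^*(t,i,U)$ denotes the maximizer in this equation, and $h^*(t,i,U)=0$ means that the supremum is attained at $\vartheta=0$, i.e. $V(t,i,U)=U(g(i)-ct)$. $V(t,i,W)$ and $h^*(t,i,W)$ are defined in the same way with $W$ in place of $U$. *)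

(* Defs.v *)
From HB Require Import structures.
From mathcomp Require Import all_boot all_order all_algebra.
From mathcomp Require Import all_classical all_reals all_analysis.
From mathcomp Require Import measurable_realfun.

Set Implicit Arguments.
Unset Strict Implicit.
Unset Printing Implicit Defensive.

Import Order.TTheory GRing.Theory Num.Theory.
Import numFieldNormedType.Exports.

Local Open Scope classical_set_scope.
Local Open Scope ring_scope.

Definition strictly_concave (R : realType) (U : R -> R) : Prop :=
  forall x y a : R, x != y -> 0 < a < 1 ->
    a * U x + (1 - a) * U y < U (a * x + (1 - a) * y).

Definition utility (R : realType) (U : R -> R) : Prop :=
  {homo U : x y / x < y} /\ strictly_concave U.

Definition twice_continuously_differentiable (R : realType) (U : R -> R)
    : Prop :=
  [/\ forall x, derivable U x 1,
      forall x, derivable (derive1 U) x 1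
    & continuous (derive1 (derive1 U))].

Definition arrow_pratt (R : realType) (U : R -> R) (x : R) : R :=
  - (derive1 (derive1 U) x / derive1 U x).

Definition more_risk_averse (R : realType) (U W : R -> R) : Prop :=
  forall x, arrow_pratt W x <= arrow_pratt U x.

Definition exit_rate (R : realType) (S : Type) (q : S -> S -> R) (i : S) : R :=
  - q i i.

Definition intensity_matrix (R : realType) (S : choiceType) (q : S -> S -> R)
    : Prop :=
  [/\ forall i j, j != i -> 0 <= q i j,
      forall i, 0 < exit_rate q i
    & forall i, (\esum_(j in [set j | j != i]) (q i j)%:E
                 = (exit_rate q i)%:E)%E].

Definition jump_prob (R : realType) (S : eqType) (q : S -> S -> R) (i j : S)
    : R :=
  if j == i then 0 else q i j / exit_rate q i.

(** [X t w] is the state at time [t]; only [t >= 0] matters.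
    [T n w] is the [n]-th jump time; [embedded X T n] is Z_n = X_{T n}. *)
Definition embedded (R : realType) (Omega S : Type) (X : R -> Omega -> S)
    (T : nat -> Omega -> R) (n : nat) (w : Omega) : S :=
  X (T n w) w.

(** The paths of [X] are right-continuous step functions with successive jump
    times [T 0 = 0 < T 1 < ...]; by the last clause these exhaust the half-line,
    so that X_t = sum_k Z_k 1{T k <= t < T (k+1)} for all t >= 0. *)
Definition step_process d dS (R : realType) (Omega : measurableType d)
    (S : measurableType dS) (X : R -> Omega -> S) (T : nat -> Omega -> R)
    : Prop :=
  [/\ (forall t, 0 <= t -> measurable_fun setT (X t)) /\
      (forall n, measurable_fun setT (T n)),
      (forall w, T 0%N w = 0) /\ (forall n w, T n w < T n.+1 w),
      forall n t w, T n w <= t < T n.+1 w -> X t w = embedded X T n w,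
      forall n w, embedded X T n.+1 w != embedded X T n w
    & forall t w, 0 <= t -> exists n, T n w <= t < T n.+1 w].

(** Jump chain / holding time description of a continuous-time Markov chain
    with intensity matrix [q]: (Z_n) is a Markov chain with transition
    probabilities [jump_prob q] and, given (Z_n), the holding times
    T (k+1) - T k are independent and exponential with rates q_{Z_k}.  The
    joint law is given on a generating pi-system. *)
Definition markov_jump_law d dS (R : realType) (Omega : measurableType d)
    (S : measurableType dS) (P : probability Omega R) (q : S -> S -> R)
    (X : R -> Omega -> S) (T : nat -> Omega -> R) : Prop :=
  forall (n : nat) (i : nat -> S) (s : nat -> R), (forall k, 0 <= s k) ->
    P [set w | (forall k, (k <= n)%N -> embedded X T k w = i k) /\
               (forall k, (k < n)%N -> s k < T k.+1 w - T k w)] =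
    (P [set w | X 0%R w = i 0%N] *
     (\prod_(k < n) (jump_prob q (i k) (i k.+1) *
                     expR (- (exit_rate q (i k) * s k))))%:E)%E.

(** [Pi i] is P( . | X_0 = i); the first clause is what remains of conditioning
    when P(X_0 = i) = 0. *)
Definition cond_start d dS (R : realType) (Omega : measurableType d)
    (S : measurableType dS) (P : probability Omega R)
    (Pi : S -> probability Omega R) (X : R -> Omega -> S) : Prop :=
  forall i, Pi i [set w | X 0%R w = i] = 1%E /\
    forall A, measurable A ->
      P (A `&` [set w | X 0%R w = i]) = (P [set w | X 0%R w = i] * Pi i A)%E.

Definition natural_filtration d dS (R : realType) (Omega : measurableType d)
    (S : measurableType dS) (X : R -> Omega -> S) (t : R) : set (set Omega) :=
  <<s \bigcup_(s in [set s : R | 0 <= s <= t])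
        preimage_set_system setT (X s) measurable >>.

(** Stopping times are [0, oo)-valued, hence automatically a.s. finite under
    every [Pi i]. *)
Definition stopping_times d dS (R : realType) (Omega : measurableType d)
    (S : measurableType dS) (X : R -> Omega -> S) : set (Omega -> R) :=
  [set tau | (forall w, 0 <= tau w) /\
    forall t, 0 <= t -> natural_filtration X t [set w | tau w <= t]].

(** Expectations are extended-real valued; in this library an expectation of
    the form oo - oo is -oo. *)
Definition assumption_A1 d dS (R : realType) (Omega : measurableType d)
    (S : measurableType dS) (Pi : S -> probability Omega R)
    (X : R -> Omega -> S) (g : S -> R) (c : R) : Prop :=
  forall i : S,
    (ereal_sup
       [set 'E_(Pi i)[fun w => (Num.max (g (X (tau w) w)) 0 - c * tau w)%R]
       | tau in stopping_times X] < +oo)%E.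

(** E_i[U(g(X_tau) - c(t + tau))] *)
Definition expected_utility d dS (R : realType) (Omega : measurableType d)
    (S : measurableType dS) (Pi : S -> probability Omega R)
    (X : R -> Omega -> S) (g : S -> R) (c : R) (U : R -> R)
    (t : R) (i : S) (tau : Omega -> R) : \bar R :=
  ('E_(Pi i)[fun w => U (g (X (tau w) w) - c * (t + tau w))%R])%E.

Definition assumption_A2 d dS (R : realType) (Omega : measurableType d)
    (S : measurableType dS) (Pi : S -> probability Omega R)
    (X : R -> Omega -> S) (T : nat -> Omega -> R) (g : S -> R) (c : R)
    (U : R -> R) : Prop :=
  forall (i : S) (t : R) (tau : Omega -> R), 0 <= t -> stopping_times X tau ->
    (expected_utility Pi X g c U t i tau <=
     limn_einf (fun n => expected_utility Pi X g c U t i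
                           (fun w => Num.min (tau w) (T n w))))%E.

(** T k + h_k(t + T k, Z_k) *)
Definition stop_candidate (R : realType) (Omega S : Type)
    (X : R -> Omega -> S) (T : nat -> Omega -> R) (h : nat -> R -> S -> \bar R)
    (t : R) (k : nat) (w : Omega) : \bar R :=
  ((T k w)%:E + h k (t + T k w)%R (embedded X T k w))%E.

Definition stops_before_jump (R : realType) (Omega S : Type)
    (X : R -> Omega -> S) (T : nat -> Omega -> R) (h : nat -> R -> S -> \bar R)
    (t : R) (w : Omega) (k : nat) : bool :=
  (stop_candidate X T h t k w < (T k.+1 w)%:E)%E.

Definition markovian_time (R : realType) (Omega S : Type)
    (X : R -> Omega -> S) (T : nat -> Omega -> R) (h : nat -> R -> S -> \bar R)
    (t : R) (w : Omega) : \bar R :=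
  match pselect (exists k, stops_before_jump X T h t w k) with
  | left stops => stop_candidate X T h t (ex_minn stops) w
  | right _ => +oo%E
  end.

Definition markovian_stopping_times d dS (R : realType)
    (Omega : measurableType d) (S : measurableType dS)
    (Pi : S -> probability Omega R) (X : R -> Omega -> S)
    (T : nat -> Omega -> R) : set (nat -> R -> S -> \bar R) :=
  [set h : nat -> R -> S -> \bar R |
    [/\ forall k, measurable_fun ([set u : R | 0 <= u] `*` [set: S])
                    (fun p : R * S => h k p.1 p.2),
        forall k u i, 0 <= u -> (0 <= h k u i)%E
      & forall i t, 0 <= t ->
          Pi i [set w | (markovian_time X T h t w < +oo)%E] = 1%E]].

(** [fine] only affects the null event where the stopping time is infinite. *)
Definition value d dS (R : realType) (Omega : measurableType d)
    (S : measurableType dS) (Pi : S -> probability Omega R)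
    (X : R -> Omega -> S) (T : nat -> Omega -> R) (g : S -> R) (c : R)
    (t : R) (i : S) (U : R -> R) : \bar R :=
  ereal_sup [set expected_utility Pi X g c U t i
                   (fun w => fine (markovian_time X T h t w))
            | h in markovian_stopping_times Pi X T].

(** [\esum] is meant for nonnegative terms. *)
Definition signed_esum (R : realType) (S : choiceType) (D : set S)
    (f : S -> \bar R) : \bar R :=
  (\esum_(j in D) (f^\+ j) - \esum_(j in D) (f^\- j))%E.

(** U(g(i) - c(t + theta)) e^{-q_i theta}
    + int_0^theta e^{-q_i s} sum_{j <> i} q_ij V(t + s, j, U) ds *)
Definition optimality_rhs d dS (R : realType) (Omega : measurableType d)
    (S : measurableType dS) (Pi : S -> probability Omega R)
    (q : S -> S -> R) (X : R -> Omega -> S) (T : nat -> Omega -> R)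
    (g : S -> R) (c : R) (t : R) (i : S) (U : R -> R) (theta : R) : \bar R :=
  ((U (g i - c * (t + theta)) * expR (- (exit_rate q i * theta)))%:E +
   \int[lebesgue_measure]_(s in `[0%R, theta])
     ((expR (- (exit_rate q i * s)))%:E *
      signed_esum [set j | j != i]
        (fun j => (q i j)%:E * value Pi X T g c (t + s)%R j U)))%E.

(** h^*(t,i,U) = theta: the supremum over theta >= 0 of [optimality_rhs], which
    is V(t,i,U) by the optimality equation, is attained at [theta].  For
    [theta = 0] this reads V(t,i,U) = U(g(i) - ct). *)
Definition is_hstar d dS (R : realType) (Omega : measurableType d)
    (S : measurableType dS) (Pi : S -> probability Omega R)
    (q : S -> S -> R) (X : R -> Omega -> S) (T : nat -> Omega -> R)
    (g : S -> R) (c : R) (t : R) (i : S) (U : R -> R) (theta : R) : Prop :=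
  0 <= theta /\
  value Pi X T g c t i U = optimality_rhs Pi q X T g c t i U theta.

(* Main.v *)
Require Import Defs.
From HB Require Import structures.
From mathcomp Require Import all_boot all_order all_algebra.
From mathcomp Require Import all_classical all_reals all_analysis.
From mathcomp Require Import measurable_realfun ring lra.
Import Order.TTheory GRing.Theory Num.Theory.
Import numFieldNormedType.Exports.
Local Open Scope classical_set_scope.
Local Open Scope ring_scope.

(** If stopping at once is optimal for the less risk-averse agent, then no
    gamble that the problem offers is worth its risk to that agent, and a more
    risk-averse agent accepts even fewer gambles.

    In analytic form, U is an increasing concave function of W: the ratio
    r = U' / W' has derivative of the sign of U'' / U' - W'' / W' <= 0
    ([derive1_ratio_nincr]), so that Cauchy's mean value theorem bounds U by an
    affine function of W that touches it at a given point x
    ([le_affine_utility]):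
      U(y) <= U(x) + r(x) (W(y) - W(x)) for all y.
    Let Y be the payoff of a Markovian time, and let x = g(i) - c t be the
    payoff of stopping at once.  Optimality of stopping at once for W says
    that E_i[W(Y)] <= W(x) for every such Y, and the expectation of the bound
    gives E_i[U(Y)] <= U(x): this is Jensen's inequality for the concave
    function relating U to W.  The time 0 is itself Markovian and yields U(x),
    so that V(t,i,U) = U(x).

    Two points need care.  The expectations are extended real-valued and W(Y),
    U(Y) may fail to be integrable; since U(Y) is dominated by an increasing
    affine function of W(Y) and E_i[W(Y)] is bounded above, every failure of
    integrability leads to E_i[U(Y)] = -oo ([expectation_le_affine]).
    And additivity of the integral requires the
    payoff of a Markovian time to be measurable, which is obtained by cutting
    the sample space according to the index of the jump interval in which the
    time falls ([measurable_payoff]). *)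

Set Implicit Arguments.
Unset Strict Implicit.
Unset Printing Implicit Defensive.

(** * Utility functions and risk aversion *)

(** Monotonicity alone gives a nonnegative derivative.  By concavity the slope
    at [x] is at least the slope of the chord from [x] to [x + 1], which is
    positive. *)
Lemma utility_derive1_gt0 (R : realType) (W : R -> R) (x : R) :
  utility W -> derivable W x 1 -> 0 < derive1 W x.
Proof.
move=> [Winc Wconc] dW.
have slope : 0 < W (x + 1) - W x by rewrite subr_gt0 Winc// ltrDl.
apply: (lt_le_trans slope).
have cvW : h^-1 *: (W (h *: 1 + x) - W x) @[h --> 0^'+] --> derive1 W x.
  by apply: cvg_dnbhs_at_right; rewrite derive1E; exact: dW.
rewrite -(cvg_lim _ cvW)//; apply: limr_ge.
  by apply/cvg_ex; exists (derive1 W x).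
near=> h.
have h0 : 0 < h by near: h; exact: nbhs_right_gt.
have h1 : h < 1 by near: h; exact: nbhs_right_lt.
rewrite /GRing.scale/= ler_pdivlMl// mulr1.
have := Wconc (x + 1) x h; rewrite h0 h1 => /(_ _ isT).
have -> : h * (x + 1) + (1 - h) * x = h + x by ring.
have -> : x + 1 != x by rewrite gt_eqF// ltrDl.
by move=> /(_ isT) /ltW; lra.
Unshelve. all: by end_near.
Qed.

(** The logarithmic derivative of [U' / W'] is the difference of the Arrow-Pratt
    functions of [W] and [U]. *)
Lemma derive1_ratio_nincr (R : realType) (U W : R -> R) :
  (forall x, 0 < derive1 U x) -> (forall x, 0 < derive1 W x) ->
  (forall x, derivable (derive1 U) x 1) ->
  (forall x, derivable (derive1 W) x 1) ->
  more_risk_averse U W ->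
  {homo (fun x => derive1 U x / derive1 W x) : x y / x <= y >-> y <= x}.
Proof.
move=> U'gt0 W'gt0 ddU ddW UW x y xy.
pose D z := (derive1 (derive1 U) z * derive1 W z -
             derive1 U z * derive1 (derive1 W) z) / derive1 W z ^+ 2.
have dr (z : R) : is_derive z 1 (fun z => derive1 U z / derive1 W z) (D z).
  have W'n0 : derive1 W z != 0 by rewrite gt_eqF.
  have dU : is_derive z 1 (derive1 U) (derive1 (derive1 U) z).
    by rewrite derive1E; apply: DeriveDef.
  have dW : is_derive z 1 (derive1 W) (derive1 (derive1 W) z).
    by rewrite derive1E; apply: DeriveDef.
  have dV := is_deriveV W'n0.
  have -> : D z = derive1 U z *: (- derive1 W z ^- 2 *: derive1 (derive1 W) z) +
                  (derive1 W z)^-1 *: derive1 (derive1 U) z.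
    by rewrite /D /GRing.scale/=; field.
  exact: is_deriveM.
apply: (@ler0_derive1_nincr R (fun z => derive1 U z / derive1 W z) x y) => //.
- move=> z _; rewrite derive1E; have -> := @derive_val _ _ _ _ _ _ _ (dr z).
  rewrite /D.
  have := UW z; rewrite /arrow_pratt lerN2.
  rewrite ler_pdivrMr// mulrAC ler_pdivlMr// => le.
  rewrite pmulr_lle0 ?invr_gt0 ?exprn_gt0// subr_le0.
  by rewrite [leRHS]mulrC.
- apply: derivable_within_continuous => z _.
  exact: (@ex_derive _ _ _ _ _ _ _ (dr z)).
Qed.

(** The right-hand side is the tangent at [W x] to the concave function that
    maps [W y] to [U y]; working with Cauchy's mean value theorem avoids
    inverting [W].  The increment of [U] is that of [W] times the ratio of
    derivatives at an intermediate point; moving this point to [x] enlarges the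
    product on both sides of [x], as the ratio decreases while the increment
    changes sign. *)
Lemma le_affine_utility (R : realType) (U W : R -> R) (x y : R) :
  (forall x, derivable U x 1) -> (forall x, derivable W x 1) ->
  (forall x, 0 < derive1 W x) ->
  {homo (fun x => derive1 U x / derive1 W x) : x y / x <= y >-> y <= x} ->
  U y <= U x + derive1 U x / derive1 W x * (W y - W x).
Proof.
move=> dU dW W'gt0 r_nincr.
have mvt a b : a < b -> exists2 z, a < z < b &
  0 < W b - W a /\ U b - U a = derive1 U z / derive1 W z * (W b - W a).
  move=> ab.
  have isd (f : R -> R) (z : R) :
      derivable f z 1 -> is_derive z 1 f (derive1 f z).
    by move=> df; rewrite derive1E; exact: DeriveDef.
  have Wab : 0 < W b - W a.
    have [| |z _ ->] := @MVT R W (derive1 W) a b ab.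
    - by move=> z _; exact: isd.
    - by apply: derivable_within_continuous => z _; exact: dW.
    - by rewrite mulr_gt0// subr_gt0.
  have [| | | | |z zab eqz] := @cauchy_MVT R U (derive1 U) W (derive1 W) a b ab.
  - by apply: derivable_within_continuous => z _; exact: dU.
  - by apply: derivable_within_continuous => z _; exact: dW.
  - by move=> z _; exact: isd.
  - by move=> z _; exact: isd.
  - by move=> z _; rewrite gt_eqF.
  exists z; first by move: zab; rewrite in_itv.
  split => //; rewrite eqz -mulrA mulVf ?mulr1// gt_eqF//.
rewrite -lerBlDl.
have [xy|yx|<-] := ltgtP x y.
- have [z /andP[xz _] [Wgt0 ->]] := mvt _ _ xy.
  by rewrite ler_pM2r//; exact/r_nincr/ltW.
- have [z /andP[_ zx] [Wgt0 e]] := mvt _ _ yx.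
  rewrite -[leLHS]opprB -[in leRHS](opprB (W x)) e mulrN lerN2 ler_pM2r//.
  exact/r_nincr/ltW.
- by rewrite !subrr mulr0.
Qed.

(** * Expectations under affine domination *)

(** Integrability is deduced from the bounds.  If the negative part of [f] is
    not integrable, then the expectation of [f] is [-oo].  Otherwise the
    domination makes the negative part of [w] integrable, the bound on the
    expectation of [w] then makes [w] integrable, and finally [f] lies between
    two integrable functions. *)
Lemma expectation_le_affine d (T : measurableType d) (R : realType)
    (P : probability T R) (f w : T -> R) (a k b : R) :
  measurable_fun setT f -> measurable_fun setT w -> 0 < k ->
  (forall x, f x <= a + k * w x) ->
  ('E_P[w] <= b%:E)%E -> ('E_P[f] <= (a + k * b)%:E)%E.
Proof.
move=> mf mw k0 fw; rewrite unlock => Ewb.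
have mEf : measurable_fun setT (EFin \o f) by exact/measurable_EFinP.
have mEw : measurable_fun setT (EFin \o w) by exact/measurable_EFinP.
pose neg (v : T -> R) x := Num.max (- v x) 0.
have negE v : ((EFin \o v)^\-)%E = EFin \o neg v.
  by apply/funext => x; rewrite funenegE /= EFin_max.
have [fNoo|fNfin] := eqVneq (\int[P]_x (EFin \o f)^\- x)%E +oo%E.
  by rewrite integralE fNoo addeNy leNye.
have ifN : P.-integrable setT (EFin \o neg f).
  rewrite -negE; apply/integrableP; split; first exact: measurable_funeneg.
  by under eq_integral do rewrite gee0_abs//; rewrite ltey.
have icst (r : R) : P.-integrable setT (EFin \o cst r).
  exact: finite_measure_integrable_cst.
have iwN : P.-integrable setT (EFin \o neg w).
  apply: (@le_integrable _ _ _ _ _ _ _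
    (fun x => (k^-1)%:E * ((neg f x)%:E + (`|a|%R)%:E))%E) => //.
  - by rewrite -negE; exact: measurable_funeneg.
  - move=> x _; rewrite -EFinD -EFinM !abse_EFin lee_fin.
    have nge v : 0 <= neg v x by rewrite le_max lexx orbT.
    rewrite ger0_norm// (le_trans _ (ler_norm _))// ler_pdivlMl//.
    rewrite {1}/neg maxr_pMr ?(ltW k0)// mulr0 ge_max addr_ge0 ?nge// andbT.
    have : - f x <= neg f x by rewrite le_max lexx.
    by have := fw x; have := ler_norm a; rewrite mulrN; lra.
  - by apply: integrableZl => //; exact: (integrableD _ ifN (icst `|a|)).
have iw : P.-integrable setT (EFin \o w).
  apply/integrableP; split => //; rewrite integral_fin_num_abs// fin_numElt.
  rewrite (le_lt_trans Ewb (ltry b)) andbT integralE.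
  rewrite (@lt_le_trans _ _ (- \int[P]_x (EFin \o w)^\- x)%E)//.
    have := integrable_fin_num measurableT iwN.
    by rewrite -negE -fin_numN fin_numElt => /andP[].
  by rewrite leeDr// integral_ge0.
have iaff : P.-integrable setT (fun x => (a + k * w x)%:E).
  exact: (integrableD _ (icst a) (integrableZl measurableT k iw)).
have iF : P.-integrable setT (EFin \o f).
  apply: (@le_integrable _ _ _ _ _ _ _
    (fun x => (neg f x)%:E + `|(a + k * w x)%:E|)%E) => //.
  - move=> x _; rewrite abse_EFin -EFinD abse_EFin lee_fin.
    rewrite (le_trans _ (ler_norm _))// ler_norml.
    have := fw x; have := ler_norm (a + k * w x).
    have : - f x <= neg f x by rewrite le_max lexx.
    have : 0 <= neg f x by rewrite le_max lexx orbT.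
    have := normr_ge0 (a + k * w x).
    by move=> *; apply/andP; split; lra.
  - by apply: integrableD => //; exact: integrable_abse.
apply: (@le_trans _ _ (\int[P]_x (a + k * w x)%:E)%E).
  by apply: le_integral => // x _; rewrite lee_fin.
have -> : (\int[P]_x (a + k * w x)%:E = a%:E + k%:E * \int[P]_x (w x)%:E)%E.
  rewrite -integralZl// -[in RHS](expectation_cst P a) unlock.
  exact: (integralD measurableT (icst a) (integrableZl measurableT k iw)).
by rewrite EFinD EFinM leeD2l// lee_wpmul2l// lee_fin ltW.
Qed.

(** * Measurability of the payoff of a Markovian time *)

Lemma jump_time_ge0 (R : realType) (Omega : Type) (T : nat -> Omega -> R) :
  (forall w, T 0 w = 0) -> (forall n w, T n w < T n.+1 w) ->
  forall n w, 0 <= T n w.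
Proof.
move=> T0 Tlt n w.
by elim: n => [|n IH]; [rewrite T0|exact: (le_trans IH (ltW (Tlt n w)))].
Qed.

(** Evaluating [X] at a random time is measurable here because the path is
    constant up to the next jump: the state after the jump is read off at some
    rational time of that interval. *)
Lemma measurable_embedded d dS (R : realType) (Omega : measurableType d)
    (S : measurableType dS) (X : R -> Omega -> S) (T : nat -> Omega -> R) n :
  step_process X T -> measurable_fun setT (embedded X T n).
Proof.
move=> [[mX mT] [T0 Tlt] XT _ _] _ B mB; rewrite setTI.
have -> : embedded X T n @^-1` B = \bigcup_(r : rat)
    ([set w | T n w <= ratr r] `&` [set w | ratr r < T n.+1 w] `&`
     (X (Num.max 0 (ratr r)) @^-1` B)).
  have T_ge0 := jump_time_ge0 T0 Tlt n.
  (* clipping at 0 changes nothing where T n w <= r, but only nonnegative times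
     have measurable sections *)
  have Xr w r : T n w <= r -> r < T n.+1 w ->
      X (Num.max 0 r) w = embedded X T n w.
    by move=> Tr rT; rewrite max_r ?(le_trans (T_ge0 w) Tr)// (XT n)// Tr.
  apply/seteqP; split => [w /= Bw|w [r _ [[/= Tr rT]]]]; last by rewrite /= Xr.
  have [r] := rat_in_itvoo (Tlt n w).
  rewrite in_itv/= => /andP[/ltW Tr rT].
  by exists r => //; split => //=; rewrite Xr.
apply: bigcupT_measurable_rat => r.
apply: measurableI; first apply: measurableI.
- rewrite -[X in measurable X]setTI.
  rewrite (_ : [set w | _] = T n @^-1` [set` `]-oo, ratr r]]); last first.
    by apply/seteqP; split => w /=; rewrite in_itv.
  by apply: mT => //; exact: measurable_itv.
- rewrite -[X in measurable X]setTI.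
  rewrite (_ : [set w | _] = T n.+1 @^-1` [set` `]ratr r, +oo[]); last first.
    by apply/seteqP; split => w /=; rewrite in_itv/= andbT.
  by apply: mT => //; exact: measurable_itv.
- rewrite -[X in measurable X]setTI.
  by apply: mX => //; rewrite le_max lexx.
Qed.

Lemma measurable_stop_candidate d dS (R : realType) (Omega : measurableType d)
    (S : measurableType dS) (X : R -> Omega -> S) (T : nat -> Omega -> R)
    (h : nat -> R -> S -> \bar R) (t : R) k :
  step_process X T -> 0 <= t ->
  measurable_fun ([set u : R | 0 <= u] `*` [set: S])
    (fun p : R * S => h k p.1 p.2) ->
  measurable_fun setT (stop_candidate X T h t k).
Proof.
move=> XT t0 mh.
have [[_ mT] [T0 Tlt] _ _ _] := XT.
have T_ge0 := jump_time_ge0 T0 Tlt k.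
apply: emeasurable_funD; first exact/measurable_EFinP.
apply: (@measurable_comp _ _ _ _ _ _ ([set u : R | 0 <= u] `*` [set: S])
  (fun p : R * S => h k p.1 p.2) _
  (fun w => (t + T k w, embedded X T k w))) => //.
- by apply: measurableX => //; rewrite -set_itvcy; exact: measurable_itv.
- by move=> _ [w _ <-]; split => //=; rewrite addr_ge0.
- apply: measurable_fun_pair; first exact: measurable_funD.
  exact: measurable_embedded.
Qed.

(** On the event that the time falls in the [k]-th jump interval, the state at
    that time is the [k]-th state of the jump chain, so that the payoff is there
    a measurable function of the [k]-th jump time and state. *)
Lemma measurable_payoff d dS (R : realType) (Omega : measurableType d)
    (S : measurableType dS) (S_discrete : forall A : set S, measurable A)
    (X : R -> Omega -> S) (T : nat -> Omega -> R)
    (h : nat -> R -> S -> \bar R) (g : S -> R) (c t : R) :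
  step_process X T -> 0 <= t ->
  (forall k, measurable_fun ([set u : R | 0 <= u] `*` [set: S])
                    (fun p : R * S => h k p.1 p.2)) ->
  (forall k u i, 0 <= u -> (0 <= h k u i)%E) ->
  measurable_fun setT (fun w =>
    g (X (fine (markovian_time X T h t w)) w) -
    c * (t + fine (markovian_time X T h t w))).
Proof.
move=> XT t0 mh h0.
have [[mX mT] [T0 Tlt] Xstep _ _] := XT.
have T_ge0 := jump_time_ge0 T0 Tlt.
have mg : measurable_fun setT g by move=> _ B _; exact: S_discrete.
have mcand k : measurable_fun setT (stop_candidate X T h t k).
  exact: measurable_stop_candidate.
pose D k := [set w | stops_before_jump X T h t w k].
have mD k : measurable (D k).
  rewrite -[D k]setTI; apply: measurable_lte => //; exact/measurable_EFinP.
(* the event of index 0 is that the time never occurs, where [fine] sends its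
   value +oo to 0 *)
pose E n := if n is k.+1 then D k `\` \bigcup_(j in `I_k) D j
            else ~` \bigcup_j D j.
have mE n : measurable (E n).
  case: n => [|k] /=.
  - by apply: measurableC; exact: bigcupT_measurable.
  - by apply: measurableD => //; exact: bigcup_measurable.
have -> : [set: Omega] = \bigcup_n E n.
  apply/seteqP; split => // w _.
  have [ex|nex] := pselect (exists k, stops_before_jump X T h t w k).
  - exists (ex_minn ex).+1 => //=; case: ex_minnP => k Dk kmin; split => //.
    by move=> [j /= jk /kmin]; rewrite leqNgt jk.
  - by exists 0%N => //= -[j _ Dj]; apply: nex; exists j.
apply/measurable_fun_bigcup => // -[|k].
- apply: (@eq_measurable_fun _ _ _ _ _ (fun w => g (X 0 w) - c * (t + 0))).
    move=> w; rewrite inE /= => nD; rewrite /markovian_time.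
    case: pselect => [[j Dj]|] //; by case: nD; exists j.
  apply: measurable_funTS; apply: measurable_funB => //.
  by apply: measurableT_comp => //; exact: mX.
- apply: (@eq_measurable_fun _ _ _ _ _ (fun w => g (embedded X T k w) -
     c * (t + fine (stop_candidate X T h t k w)))).
    move=> w; rewrite inE /= => -[Dk nD]; rewrite /markovian_time.
    case: pselect => [ex|] //; last by case; exists k.
    have -> : ex_minn ex = k.
      case: ex_minnP => m Dm mmin; apply/eqP; rewrite eqn_leq mmin//= leqNgt.
      by apply/negP => mk; apply: nD; exists m.
    rewrite (Xstep k)//.
    move: Dk; rewrite /D /= /stops_before_jump.
    have : ((T k w)%:E <= stop_candidate X T h t k w)%E.
      by rewrite leeDl// h0// addr_ge0.
    case: (stop_candidate X T h t k w) => [r| |] //.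
    by rewrite lee_fin lte_fin /= => -> ->.
  apply: measurable_funTS; apply: measurable_funB.
    by apply: measurableT_comp => //; exact: measurable_embedded.
  apply: measurable_funM => //; apply: measurable_funD => //.
  by apply: measurableT_comp => //; exact: fine_measurable.
Qed.

(** * Stopping at once *)

Lemma expected_utility_0 d dS (R : realType) (Omega : measurableType d)
    (S : measurableType dS) (S_discrete : forall A : set S, measurable A)
    (P : probability Omega R) (Pi : S -> probability Omega R)
    (X : R -> Omega -> S) (g : S -> R) (c : R) (U : R -> R) (t : R) (i : S) :
  measurable_fun setT (X 0) -> cond_start P Pi X ->
  expected_utility Pi X g c U t i (fun=> 0) = (U (g i - c * t))%:E.
Proof.
move=> mX Pi_cond; rewrite /expected_utility.
rewrite -(expectation_cst (Pi i)) unlock.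
have mA : measurable [set w | X 0 w = i].
  rewrite -[X in measurable X]setTI.
  by apply: (mX measurableT [set i]); exact: S_discrete.
have mV : measurable_fun [set: S] (fun j => U (g j - c * (t + 0))).
  by move=> _ B _; exact: S_discrete.
have X0i : \forall w \ae Pi i, X 0 w = i.
  apply/negligibleP; first exact: measurableC.
  by have := probability_setC (Pi i) mA; rewrite (proj1 (Pi_cond i)) subee.
apply: ae_eq_integral => //.
- exact/measurable_EFinP/(measurableT_comp mV mX).
- exact/measurable_EFinP/measurable_cst.
- by apply: filterS X0i => w /= -> _; rewrite addr0.
Qed.

Lemma markovian_time0 d dS (R : realType) (Omega : measurableType d)
    (S : measurableType dS) (X : R -> Omega -> S) (T : nat -> Omega -> R)
    (t : R) :
  step_process X T -> markovian_time X T (fun _ _ _ => 0%E) t = (fun=> 0%E).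
Proof.
move=> [_ [T0 Tlt] _ _ _]; apply/funext => w.
have st0 : stops_before_jump X T (fun _ _ _ => 0%E) t w 0.
  by rewrite /stops_before_jump /stop_candidate adde0 lte_fin.
rewrite /markovian_time; case: pselect => [ex|]; last by case; exists 0%N.
case: ex_minnP => m _ /(_ _ st0); rewrite leqn0 => /eqP ->.
by rewrite /stop_candidate T0 adde0.
Qed.

Lemma markovian_stopping_times0 d dS (R : realType) (Omega : measurableType d)
    (S : measurableType dS) (Pi : S -> probability Omega R)
    (X : R -> Omega -> S) (T : nat -> Omega -> R) :
  step_process X T -> markovian_stopping_times Pi X T (fun _ _ _ => 0%E).
Proof.
move=> XT; split => [k||i t _] //.
rewrite markovian_time0// (_ : [set _ | _] = setT) ?probability_setT//.
by apply/seteqP; split => // w _ /=; exact: ltry.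
Qed.

Lemma optimality_rhs0 d dS (R : realType) (Omega : measurableType d)
    (S : measurableType dS) (Pi : S -> probability Omega R)
    (q : S -> S -> R) (X : R -> Omega -> S) (T : nat -> Omega -> R)
    (g : S -> R) (c t : R) (i : S) (U : R -> R) :
  optimality_rhs Pi q X T g c t i U 0 = (U (g i - c * t))%:E.
Proof.
rewrite /optimality_rhs set_itv1 integral_set1 adde0 !addr0 mulr0 oppr0 expR0.
by rewrite mulr1.
Qed.

(** * The comparison theorem *)

Theorem theorem7p1 (R : realType) (d dS : measure_display)
    (Omega : measurableType d) (S : measurableType dS)
    (S_countable : countable [set: S])
    (S_discrete : forall A : set S, measurable A)
    (P : probability Omega R) (Pi : S -> probability Omega R)
    (q : S -> S -> R) (X : R -> Omega -> S) (T : nat -> Omega -> R)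
    (g : S -> R) (c : R) (c_gt0 : 0 < c)
    (q_intensity : intensity_matrix q)
    (X_step : step_process X T)
    (P_law : markov_jump_law P q X T)
    (Pi_cond : cond_start P Pi X)
    (Pi_law : forall i, markov_jump_law (Pi i) q X T)
    (U W : R -> R)
    (U_utility : utility U) (W_utility : utility W)
    (U_C2 : twice_continuously_differentiable U)
    (W_C2 : twice_continuously_differentiable W)
    (A1 : assumption_A1 Pi X g c)
    (A2_U : assumption_A2 Pi X T g c U)
    (A2_W : assumption_A2 Pi X T g c W)
    (U_more_averse : more_risk_averse U W) :
  forall (t : R) (i : S), 0 <= t ->
    is_hstar Pi q X T g c t i W 0 -> is_hstar Pi q X T g c t i U 0.
Proof.
move=> t i t0 [_ VW]; split => //; move: VW; rewrite !optimality_rhs0 => VW.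
have [dU ddU _] := U_C2.
have [dW ddW _] := W_C2.
have U'gt0 x : 0 < derive1 U x by exact: utility_derive1_gt0.
have W'gt0 x : 0 < derive1 W x by exact: utility_derive1_gt0.
have mX0 : measurable_fun setT (X 0).
  by case: X_step => [[mX _] _ _ _ _]; exact: mX.
apply/eqP; rewrite eq_le; apply/andP; split; last first.
  apply: ereal_sup_ubound; exists (fun _ _ _ => 0%E).
    exact: markovian_stopping_times0.
  rewrite markovian_time0//.
  exact: (expected_utility_0 S_discrete g c U t i mX0 Pi_cond).
apply: ge_ereal_sup => _ [h hM <-].
have : (expected_utility Pi X g c W t i
    (fun w => fine (markovian_time X T h t w)) <= (W (g i - c * t))%:E)%E.
  by rewrite -VW; apply: ereal_sup_ubound; exists h.
case: hM => mh h_ge0 _.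
have mY := measurable_payoff S_discrete g c X_step t0 mh h_ge0.
have mcomp (V : R -> R) : (forall x, derivable V x 1) -> measurable_fun setT
    (fun w => V (g (X (fine (markovian_time X T h t w)) w) -
                 c * (t + fine (markovian_time X T h t w)))).
  move=> dV; apply: (measurableT_comp _ mY).
  apply: continuous_measurable_fun => x.
  exact/differentiable_continuous/derivable1_diffP.
rewrite /expected_utility; set x0 := g i - c * t.
set k := derive1 U x0 / derive1 W x0.
(* U x0 is the value at W x0 of the affine function with slope k and intercept
   U x0 - k * W x0 *)
rewrite -[U x0](addrNK (k * W x0)).
apply: expectation_le_affine; [exact: mcomp|exact: mcomp|exact: divr_gt0|].
move=> w; rewrite addrAC -addrA -mulrBr.
by apply: le_affine_utility => //; exact: derive1_ratio_nincr.
Qed.
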